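(* Let $\sigma=\nu_{f,g}$ be an energy measure of harmonic functions on $SG$ and let $F_wSG$ be a cell. Let $L$ be the union of the three edges of the cell, i.e. of the line segments joining the points $F_wq_0,F_wq_1,F_wq_2$ pairwise. Then the restriction of the derivative $\frac{d\nu_{f,g}}{d\nu}$ to $L\cap V_*$ is a continuous function on $L\cap V_*$ (with the topology induced from $\mathbb{R}^2$).
   Context: Let $q_0,q_1,q_2$ be the vertices of an equilateral triangle in $\mathbb{R}^2$, $F_i(x)=\frac12(x+q_i)$, and let $SG$ be the unique nonempty compact set with $SG=\bigcup_{i=0}^2F_i(SG)$. For a finite (possibly empty) word $w=(w_1,\dots,w_m)$ in $\{0,1,2\}$ put $|w|=m$, $F_w=F_{w_1}\circ\cdots\circ F_{w_m}$; the sets $F_wSG$ are cells; $V_*$ is the set of all points $F_w(q_j)$. For continuous $u,v$ on $SG$ put $\mathcal{E}_m(u,v)=\left(\frac53\right)^m\sum_{|w|=m}\sum_{i<j}(u(F_wq_i)-u(F_wq_j))(v(F_wq_i)-v(F_wq_j))$, $\mathcal{E}(u,v)=\lim_m\mathcal{E}_m(u,v)$ (finite energy). A function $h$ is harmonic if $\mathcal{E}_m(h,h)$ is independent of $m$; harmonic functions are uniquely determined by arbitrary values at $q_0,q_1,q_2$, and $h_i$ is the harmonic function with $h_i(q_j)=\delta_{ij}$. For $f,g$ harmonic, $\nu_{f,g}$ is the signed Borel measure on $SG$ with $\nu_{f,g}(F_wSG)=\left(\frac53\right)^{|w|}\mathcal{E}(f\circ F_w,g\circ F_w)$ for all $w$;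 $\nu_i=\nu_{h_i,h_i}$; $\nu=\nu_0+\nu_1+\nu_2$ (Kusuoka measure). The energy measures of harmonic functions form the three-dimensional space with basis $\nu_0,\nu_1,\nu_2$; the notation $\nu_{f,g}$ is used for any element of it. At a point $x=F_vq_j\in V_*$, the derivative is $\frac{d\nu_{f,g}}{d\nu}(x)=\lim_{m\to\infty}\frac{\nu_{f,g}(F_vF_j^mSG)}{\nu(F_vF_j^mSG)}$; this limit exists and does not depend on the representation $x=F_vq_j$. *)

(* Defs.v *)
From HB Require Import structures.
From mathcomp Require Export all_boot all_order all_algebra.
From mathcomp Require Export all_classical all_reals all_analysis.
Set Implicit Arguments.
Unset Strict Implicit.
Unset Printing Implicit Defensive.
Import Order.TTheory GRing.Theory Num.Theory.
Import numFieldNormedType.Exports.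
Local Open Scope classical_set_scope.
Local Open Scope ring_scope.

Definition borel_plane (R : realType) :=
  g_sigma_algebraType (@open (R * R)%type).

(* The norm of [R * R] is the sup norm; its topology is the usual one, but
   equilaterality has to be stated with the Euclidean distance. *)
Definition edist (R : realType) (x y : R * R) : R :=
  Num.sqrt ((x.1 - y.1) ^+ 2 + (x.2 - y.2) ^+ 2).

Definition equilateral (R : realType) (q : 'I_3 -> R * R) : Prop :=
  exists2 l : R, 0 < l & forall i j : 'I_3, i != j -> edist (q i) (q j) = l.

Definition Fmap (R : realType) (q : 'I_3 -> R * R) (i : 'I_3) (x : R * R) :
  R * R := 2^-1 *: (x + q i).

(* F_w = F_{w_1} o ... o F_{w_m}: the first letter is applied last *)
Definition Fword (R : realType) (q : 'I_3 -> R * R) (w : seq 'I_3) :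
  R * R -> R * R := foldr (fun i f => Fmap q i \o f) id w.

Definition is_SG (R : realType) (q : 'I_3 -> R * R) (SG : set (R * R)) : Prop :=
  [/\ SG !=set0, compact SG & SG = \bigcup_i (Fmap q i @` SG)].

Definition cell (R : realType) (q : 'I_3 -> R * R) (SG : set (R * R))
  (w : seq 'I_3) : set (R * R) := Fword q w @` SG.

Definition Vstar (R : realType) (q : 'I_3 -> R * R) : set (R * R) :=
  [set x | exists (w : seq 'I_3) (j : 'I_3), x = Fword q w (q j)].

(* Functions on SG are represented by total functions on the plane, of which
   only the values on SG are ever used. *)
Definition energy_level (R : realType) (q : 'I_3 -> R * R)
    (u v : R * R -> R) (m : nat) : R :=
  (5 / 3) ^+ m *
  \sum_(w : m.-tuple 'I_3) \sum_(i < 3) \sum_(j < 3 | (i < j)%N)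
    (u (Fword q w (q i)) - u (Fword q w (q j))) *
    (v (Fword q w (q i)) - v (Fword q w (q j))).

Definition energy (R : realType) (q : 'I_3 -> R * R) (u v : R * R -> R) : R :=
  lim (energy_level q u v m @[m --> \oo]).

Definition harmonic (R : realType) (q : 'I_3 -> R * R) (SG : set (R * R))
    (h : R * R -> R) : Prop :=
  {within SG, continuous h} /\
  forall m n : nat, energy_level q h h m = energy_level q h h n.

(* A signed Borel measure on SG is a charge on the Borel sets of the plane that
   vanishes on the Borel sets disjoint from SG. *)
Definition carried_by (R : realType) (SG : set (R * R))
    (mu : {charge set (borel_plane R) -> \bar R}) : Prop :=
  forall A : set (borel_plane R), measurable A -> A `&` SG = set0 ->
    mu A = 0%E.

Definition is_energy_measure (R : realType) (q : 'I_3 -> R * R)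
    (SG : set (R * R)) (f g : R * R -> R)
    (mu : {charge set (borel_plane R) -> \bar R}) : Prop :=
  carried_by SG mu /\
  forall w : seq 'I_3, mu (cell q SG w) =
    ((5 / 3) ^+ size w * energy q (f \o Fword q w) (g \o Fword q w))%:E.

(* Membership in the vector space of energy measures of harmonic functions. The
   measures nu_{f,g} with f and g harmonic span it but do not fill it: a
   positive definite element, such as the Kusuoka measure, is not a single
   nu_{f,g}. Hence the finite linear combination. *)
Definition harmonic_energy_measure (R : realType) (q : 'I_3 -> R * R)
    (SG : set (R * R)) (sigma : {charge set (borel_plane R) -> \bar R}) :
    Prop :=
  exists (n : nat) (c : 'I_n -> R) (f g : 'I_n -> R * R -> R)
         (mu : 'I_n -> {charge set (borel_plane R) -> \bar R}),
    (forall k : 'I_n, [/\ harmonic q SG (f k), harmonic q SG (g k) &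
                          is_energy_measure q SG (f k) (g k) (mu k)]) /\
    (forall A : set (borel_plane R), measurable A ->
      sigma A = (\sum_(k < n) (c k)%:E * mu k A)%E).

Definition harmonic_basis (R : realType) (q : 'I_3 -> R * R)
    (SG : set (R * R)) (h : 'I_3 -> R * R -> R) : Prop :=
  forall i : 'I_3, harmonic q SG (h i) /\
    forall j : 'I_3, h i (q j) = (i == j)%:R.

Definition kusuoka (R : realType)
    (nu : 'I_3 -> {charge set (borel_plane R) -> \bar R})
    (A : set (borel_plane R)) : \bar R := (\sum_(i < 3) nu i A)%E.

Definition cell_ratio (R : realType) (q : 'I_3 -> R * R) (SG : set (R * R))
    (sigma nu : set (borel_plane R) -> \bar R) (v : seq 'I_3) (j : 'I_3)
    (m : nat) : R :=
  fine (sigma (cell q SG (v ++ nseq m j))) /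
  fine (nu (cell q SG (v ++ nseq m j))).

(* The common limit of the ratios over all representations x = F_v q_j; the
   value is meaningful only for x in V_*. *)
Definition energy_derivative (R : realType) (q : 'I_3 -> R * R)
    (SG : set (R * R)) (sigma nu : set (borel_plane R) -> \bar R)
    (x : R * R) : R :=
  get [set l : R | forall (v : seq 'I_3) (j : 'I_3), x = Fword q v (q j) ->
    cell_ratio q SG sigma nu v j m @[m --> \oo] --> l].

Definition segment (R : realType) (a b : R * R) : set (R * R) :=
  [set (1 - t) *: a + t *: b | t in `[0%R, 1%R]%classic].

Definition cell_edges (R : realType) (q : 'I_3 -> R * R) (w : seq 'I_3) :
    set (R * R) :=
  [set x | exists i j : 'I_3,
    i != j /\ segment (Fword q w (q i)) (Fword q w (q j)) x].

(* Main.v *)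
Require Import Defs.
From mathcomp Require Import ring lra.

(** Everything about harmonic functions is finite-dimensional. A harmonic [f]
    is determined on a subcell by its three values at the corners of the cell,
    through the extension rule ([harmonic_extension_rule]): otherwise replacing
    its values at the midpoints would lower the energy. The energy of [f] on a
    cell is then the Dirichlet form of its three corner values
    ([energy_extension_rule]).

    Write [flux X j] for the normal derivative [2 X_j - X_k - X_l] of corner
    values [X] at the corner [j]. Passing to the subcell at [j] multiplies the
    flux at [j] by 3/5 and the antisymmetric difference [X_k - X_l] by 1/5,
    while the Dirichlet form is, up to constants, the sum of the squares of
    the two. So only fluxes survive in the limit of the quotients of measures,
    and the derivative of the measure [sum_k c_k nu_{f_k, g_k}] at the vertex
    [F_v q_j] is

      sum_k c_k flux(f_k) flux(g_k) / sum_i flux(h_i)^2,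

    with all fluxes taken at the corner [j] of the cell [v]
    ([cell_ratio_cvg]). The quotient depends only on the flux functional
    [f |-> flux f] up to a nonzero scalar. Two addresses of the same vertex
    yield proportional functionals ([flux_address]), because the fluxes of a
    harmonic function out of the two cells meeting at a vertex cancel; hence
    the derivative is well defined ([energy_derivativeE]).

    Along the edge of a cell from its corner [i] to its corner [j] the flux
    functional is proportional to [t flux_i - (1 - t) flux_j], where
    [t] in [0, 1] is obtained from the address of the vertex by composing the
    two fractional linear maps

      t |-> (1 + 2 t) / (2 + t)    and    t |-> t / (3 - t),

    one for each half of the edge ([flux_edge]). The opposite signs of the two
    coefficients are what keeps [t] in [0, 1], where both maps contract by the
    factor 3/4. They also agree at the midpoint of the edge, so that vertices
    at distance less than [2^-m] in the edge coordinate have values of [t]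
    within [2 (3/4)^m] of one another ([edge_slope_close]). Thus [t] is
    uniformly continuous on the vertices of the edge, and the derivative is a
    continuous function of [t]. The three edges are closed, so continuity on
    each of them gives continuity on their union. *)

Set Implicit Arguments.
Unset Strict Implicit.
Unset Printing Implicit Defensive.
Import Order.TTheory GRing.Theory Num.Theory.
Import numFieldNormedType.Exports.
Local Open Scope classical_set_scope.
Local Open Scope ring_scope.

(** * Harmonic extension from a cell to its three subcells *)

(** The three indices are written [0], [1], [1 + 1] in the ring ['I_3], so that
    cyclic shifts of indices make sense and reduce. *)
Lemma ord3_ind (P : 'I_3 -> Prop) :
  P 0 -> P 1 -> P (1 + 1) -> forall i, P i.
Proof.
move=> P0 P1 P2 [[|[|[|//]]] lti].
- by have <- : 0 = Ordinal lti :> 'I_3 by apply: val_inj.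
- by have <- : 1 = Ordinal lti :> 'I_3 by apply: val_inj.
- by have <- : 1 + 1 = Ordinal lti :> 'I_3 by apply: val_inj.
Qed.

Lemma sum_ord3 (R : nmodType) (F : 'I_3 -> R) :
  \sum_i F i = F 0 + F 1 + F (1 + 1).
Proof.
rewrite !big_ord_recl big_ord0 addr0 addrA.
by congr (F _ + F _ + F _); apply: val_inj.
Qed.

Definition dirichlet (R : pzRingType) (X Y : 'I_3 -> R) : R :=
  \sum_(i < 3) \sum_(j < 3 | (i < j)%N) (X i - X j) * (Y i - Y j).

(** Corner values, on the subcell [a], of the harmonic extension of the corner
    values [X]: the midpoint of the edge [a b] receives
    [(2 X_a + 2 X_b + X_c) / 5]. *)
Definition extend {R : unitRingType} (X : 'I_3 -> R) (a b : 'I_3) : R :=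
  if a == b then X a else (X a + X b + \sum_i X i) / 5.

(** The normal derivative [2 X_j - X_k - X_l] at the corner [j]. *)
Definition flux (R : pzRingType) (X : 'I_3 -> R) (j : 'I_3) : R :=
  X j *+ 3 - \sum_i X i.

Lemma dirichletE (R : comPzRingType) (X Y : 'I_3 -> R) :
  dirichlet X Y = (X 0 - X 1) * (Y 0 - Y 1) +
    (X 0 - X (1 + 1)) * (Y 0 - Y (1 + 1)) +
    (X 1 - X (1 + 1)) * (Y 1 - Y (1 + 1)).
Proof.
by rewrite /dirichlet sum_ord3 !(big_mkcond (fun j : 'I_3 => (_ < j)%N)) /=
  !sum_ord3 /= !add0r !addr0.
Qed.

Lemma dirichlet_ge0 (R : realFieldType) (X : 'I_3 -> R) : 0 <= dirichlet X X.
Proof. by rewrite dirichletE -!expr2 !addr_ge0 ?sqr_ge0. Qed.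

Lemma dirichlet_extend (R : realFieldType) (X Y : 'I_3 -> R) :
  \sum_a dirichlet (extend X a) (extend Y a) = 3 / 5 * dirichlet X Y.
Proof. by rewrite sum_ord3 !dirichletE /extend /= !sum_ord3; field. Qed.

(** The harmonic extension is orthogonal, for the energy of the next level, to
    all functions vanishing at the three corners. Here [Y a b] is the value at
    the corner [b] of the subcell [a]; symmetry of [Y] says that the subcells
    [a] and [b] share the midpoint of the edge [a b]. *)
Lemma dirichlet_pythagoras (R : realFieldType) (X : 'I_3 -> R)
    (Y : 'I_3 -> 'I_3 -> R) :
  (forall a, Y a a = X a) -> (forall a b, Y a b = Y b a) ->
  \sum_a dirichlet (Y a) (Y a) = 3 / 5 * dirichlet X X +
    \sum_a dirichlet (Y a \- extend X a) (Y a \- extend X a).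
Proof.
move=> YX Ysym; rewrite !sum_ord3 !dirichletE /= /extend /= !sum_ord3.
rewrite (YX 0) (YX 1) (YX (1 + 1)).
rewrite (Ysym 1 0) (Ysym (1 + 1) 0) (Ysym (1 + 1) 1).
by field.
Qed.

Lemma dirichlet_eq0 (R : realFieldType) (X : 'I_3 -> R) (a b : 'I_3) :
  dirichlet X X = 0 -> X a = X b.
Proof.
rewrite dirichletE -!expr2 => /eqP.
rewrite !paddr_eq0 ?addr_ge0 ?sqr_ge0 // !sqrf_eq0 !subr_eq0.
case/andP=> /andP[/eqP e1 /eqP e2] /eqP e3.
by move: a b; apply: ord3_ind; apply: ord3_ind; lra.
Qed.

(** The excess over the minimum is the energy of the difference with the
    harmonic extension; on each subcell this difference vanishes at one corner,
    hence everywhere as soon as its energy is zero. *)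
Lemma extend_minimizes (R : realFieldType) (X : 'I_3 -> R)
    (Y : 'I_3 -> 'I_3 -> R) :
  (forall a, Y a a = X a) -> (forall a b, Y a b = Y b a) ->
  3 / 5 * dirichlet X X <= \sum_a dirichlet (Y a) (Y a) ?=
    iff [forall a, [forall b, Y a b == extend X a b]].
Proof.
move=> YX Ysym; rewrite (dirichlet_pythagoras YX Ysym).
split; first by rewrite lerDl sumr_ge0 // => a _; apply: dirichlet_ge0.
rewrite -subr_eq0 opprD addNKr oppr_eq0 psumr_eq0; last first.
  by move=> a _; apply: dirichlet_ge0.
apply/allP/forallP => [Z0 a | YE a _].
  have /eqP Za := Z0 a (mem_index_enum a).
  apply/forallP => b; rewrite -subr_eq0.
  by have /= -> := dirichlet_eq0 b a Za; rewrite /extend eqxx YX subrr.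
have Z0 b : (Y a \- extend X a) b = 0.
  by have /forallP/(_ b)/eqP /= -> := YE a; rewrite subrr.
by rewrite dirichletE !Z0 !subrr !mulr0 !addr0 eqxx.
Qed.

(** * Flux and iterated extension towards a corner *)

Lemma flux_extend_same (R : realFieldType) (X : 'I_3 -> R) (a : 'I_3) :
  flux (extend X a) a = 3 / 5 * flux X a.
Proof.
by move: a; apply: ord3_ind; rewrite /flux !sum_ord3 /extend /= !sum_ord3; field.
Qed.

(** The right-hand side is antisymmetric in [a] and [b]: the fluxes out of the
    two subcells [a] and [b] at their common vertex cancel. *)
Lemma flux_extend_other (R : realFieldType) (X : 'I_3 -> R) (a b : 'I_3) :
  a != b -> flux (extend X a) b = (flux X b - flux X a) / 5.
Proof.
 by move: a b; apply: ord3_ind; apply: ord3_ind => // _;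
  rewrite /flux !sum_ord3 /extend /= !sum_ord3; field.
Qed.

(** In terms of the two other corners [k] and [l], this is
    [3/2 (X_k - X_l) (Y_k - Y_l)], the part of the Dirichlet form coming from
    functions antisymmetric under the reflection that fixes [j]. *)
Definition antisym_part (R : realFieldType) (j : 'I_3) (X Y : 'I_3 -> R) : R :=
  dirichlet X Y - flux X j * flux Y j / 2.

Lemma antisym_part_extend (R : realFieldType) (j : 'I_3) (X Y : 'I_3 -> R) :
  antisym_part j (extend X j) (extend Y j) = antisym_part j X Y / 25.
Proof.
by move: j; apply: ord3_ind; rewrite /antisym_part !dirichletE /flux !sum_ord3
  /extend /= !sum_ord3; field.
Qed.

Lemma flux_iter_extend (R : realFieldType) (j : 'I_3) (m : nat) (X : 'I_3 -> R) :
  flux (iter m (extend^~ j) X) j = (3 / 5) ^+ m * flux X j.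
Proof.
elim: m => [|m IHm] /=; first by rewrite mul1r.
by rewrite flux_extend_same IHm mulrA -exprS.
Qed.

Lemma antisym_part_iter_extend (R : realFieldType) (j : 'I_3) (m : nat) (X Y : 'I_3 -> R) :
  antisym_part j (iter m (extend^~ j) X) (iter m (extend^~ j) Y) =
  25^-1 ^+ m * antisym_part j X Y.
Proof.
elim: m => [|m IHm] /=; first by rewrite mul1r.
by rewrite antisym_part_extend IHm mulrC mulrA -exprS.
Qed.

(** The antisymmetric part is smaller than the flux part by the factor
    [(1/25) / (9/25) = 1/9] at each step. *)
Lemma dirichlet_iter_extend (R : realFieldType) (j : 'I_3) (m : nat)
    (X Y : 'I_3 -> R) :
  dirichlet (iter m (extend^~ j) X) (iter m (extend^~ j) Y) =
  (9 / 25) ^+ m / 2 *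
    (flux X j * flux Y j + 9^-1 ^+ m * (antisym_part j X Y *+ 2)).
Proof.
have -> : dirichlet (iter m (extend^~ j) X) (iter m (extend^~ j) Y) =
  flux (iter m (extend^~ j) X) j * flux (iter m (extend^~ j) Y) j / 2 +
  antisym_part j (iter m (extend^~ j) X) (iter m (extend^~ j) Y).
  by rewrite /antisym_part addrC subrK.
rewrite antisym_part_iter_extend !flux_iter_extend.
have -> : (9 / 25 : R) = 3 / 5 * (3 / 5) by field.
have -> : (25^-1 : R) = 3 / 5 * (3 / 5) * 9^-1 by field.
by rewrite !exprMn; field.
Qed.

(** * Harmonic functions obey the extension rule *)

Lemma sum_tuple_rcons (R : nmodType) (T : finType) (m : nat) (G : seq T -> R) :
  \sum_(w : m.+1.-tuple T) G w = \sum_(w : m.-tuple T) \sum_a G (rcons w a).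
Proof.
rewrite pair_bigA /=.
rewrite (reindex (fun p : m.-tuple T * T => [tuple of rcons p.1 p.2])) //=.
apply: onW_bij; apply: inj_card_bij.
  move=> [s a] [s' a'] /(congr1 val) /= /rcons_inj[ss' ->].
  by congr pair; apply: val_inj.
by rewrite card_prod !card_tuple expnS mulnC.
Qed.

Lemma Fword_cat (R : realType) (q : 'I_3 -> R * R) (u v : seq 'I_3) x :
  Fword q (u ++ v) x = Fword q u (Fword q v x).
Proof. by elim: u => //= a u ->. Qed.

Lemma Fmap_fix (R : realType) (q : 'I_3 -> R * R) a : Fmap q a (q a) = q a.
Proof. by rewrite /Fmap -mulr2n -[q a *+ 2]scaler_nat scalerA mulVf ?scale1r. Qed.

Lemma Fmap_swap (R : realType) (q : 'I_3 -> R * R) a b :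
  Fmap q a (q b) = Fmap q b (q a).
Proof. by rewrite /Fmap addrC. Qed.

Definition corner_values (R : realType) (q : 'I_3 -> R * R) (f : R * R -> R)
  (w : seq 'I_3) (i : 'I_3) : R := f (Fword q w (q i)).

Definition extension_rule (R : realType) (q : 'I_3 -> R * R) (f : R * R -> R) :=
  forall w a, corner_values q f (rcons w a) = extend (corner_values q f w) a.

Lemma energy_levelE (R : realType) (q : 'I_3 -> R * R) (f g : R * R -> R) m :
  energy_level q f g m =
  (5 / 3) ^+ m * \sum_(w : m.-tuple 'I_3) dirichlet (corner_values q f w) (corner_values q g w).
Proof. by []. Qed.

(** Constancy of the energy between the levels [size w] and [(size w).+1] is
    the equality case of a sum of the inequalities of [extend_minimizes] over
    all words of that length, so that equality holds for every single word. *)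
Lemma harmonic_extension_rule (R : realType) (q : 'I_3 -> R * R)
    (SG : set (R * R)) (f : R * R -> R) :
  harmonic q SG f -> extension_rule q f.
Proof.
move=> [_ Econst] w a.
have Fsub u c d : corner_values q f (rcons u c) d = f (Fword q u (Fmap q c (q d))).
  by rewrite /corner_values -cats1 Fword_cat.
(* The hypotheses of [extend_minimizes] hold because F_c fixes q_c and
   F_c q_d = F_d q_c. *)
have minw u := extend_minimizes
  (X := corner_values q f u) (Y := fun c => corner_values q f (rcons u c))
  (fun c => etrans (Fsub u c c) (congr1 (f \o Fword q u) (Fmap_fix q c)))
  (fun c d => etrans (Fsub u c d) (etrans
    (congr1 (f \o Fword q u) (Fmap_swap q c d)) (esym (Fsub u d c)))).
have [_] := leif_sum (P := predT)
  (fun (u : (size w).-tuple 'I_3) (_ : true) => minw (tval u)).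
rewrite -mulr_sumr -(sum_tuple_rcons _ (fun u => dirichlet (corner_values q f u) (corner_values q f u))).
have := Econst (size w).+1 (size w); rewrite !energy_levelE exprS => Eeq.
have /eqP -> : 3 / 5 * (\sum_(u : (size w).-tuple 'I_3)
      dirichlet (corner_values q f u) (corner_values q f u)) ==
    \sum_(u : (size w).+1.-tuple 'I_3) dirichlet (corner_values q f u) (corner_values q f u).
  rewrite -(inj_eq (mulfI (_ : (5 / 3) ^+ (size w).+1 != 0 :> R))); last first.
    by rewrite expf_neq0.
  by rewrite exprS Eeq; apply/eqP; field.
rewrite eqxx => /esym/forallP/(_ (in_tuple w))/forallP/(_ a)/forallP minwa.
by apply/funext => b; have /eqP := minwa b.
Qed.

(** The renormalized energies of the pair are the same at all levels by
    [dirichlet_extend], so that the limit is the value at level 0. *)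
Lemma energy_extension_rule (R : realType) (q : 'I_3 -> R * R)
    (f g : R * R -> R) (u : seq 'I_3) :
  extension_rule q f -> extension_rule q g ->
  energy q (f \o Fword q u) (g \o Fword q u) =
  dirichlet (corner_values q f u) (corner_values q g u).
Proof.
move=> ef eg; rewrite /energy.
have cornerE h w : corner_values q (h \o Fword q u) w = corner_values q h (u ++ w).
  by apply/funext => i; rewrite /corner_values Fword_cat.
suff -> : energy_level q (f \o Fword q u) (g \o Fword q u) =
          fun=> dirichlet (corner_values q f u) (corner_values q g u) by rewrite lim_cst.
apply/funext => m; rewrite energy_levelE; elim: m => [|m IHm].
  rewrite expr0 mul1r (eq_bigl (pred1 [tuple])) => [|t]; last first.
    by apply/esym/eqP/val_inj; case: t => -[].
  by rewrite big_pred1_eq !cornerE cats0.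
rewrite (sum_tuple_rcons _ (fun w => dirichlet (corner_values q (f \o Fword q u) w) 
  (corner_values q (g \o Fword q u) w))) -[RHS]IHm exprS.
rewrite [5 / 3 * _]mulrC -mulrA; congr (_ * _); rewrite mulr_sumr.
apply: eq_bigr => w _; rewrite !cornerE.
under eq_bigr => a _ do rewrite !cornerE -!rcons_cat ef eg.
by rewrite dirichlet_extend; field.
Qed.

Lemma corner_nseq (R : realType) (q : 'I_3 -> R * R) (f : R * R -> R) v j m :
  extension_rule q f ->
  corner_values q f (v ++ nseq m j) = iter m (extend^~ j) (corner_values q f v).
Proof.
move=> ef; elim: m => [|m IHm]; first by rewrite cats0.
by rewrite -[m.+1 in LHS]addn1 nseqD cats1 -rcons_cat ef IHm.
Qed.

(** * The measure of a cell and the limit of the ratios *)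

Lemma Fword_continuous (R : realType) (q : 'I_3 -> R * R) w :
  continuous (Fword q w).
Proof.
elim: w => [|a w IHw] x /=; first exact: cvg_id.
rewrite /Fmap /comp; apply: cvgZr; apply: cvgD; first exact: IHw.
exact: cvg_cst.
Qed.

Lemma measurable_cell (R : realType) (q : 'I_3 -> R * R) (SG : set (R * R)) w :
  compact SG -> measurable (cell q SG w : set (borel_plane R)).
Proof.
move=> cSG; have clos : closed (cell q SG w).
  apply: compact_closed; first exact: norm_hausdorff.
  by apply: continuous_compact cSG; apply/continuous_subspaceT/Fword_continuous.
rewrite -[cell q SG w]setCK; apply: measurableC.
by apply: sub_sigma_algebra; apply: closed_openC.
Qed.

(** The factor in front of the sum is common to all energy measures and cancels
    in the quotient of two of them. *)
Lemma energy_measure_cell (R : realType) (q : 'I_3 -> R * R) (SG : set (R * R))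
    (f g : R * R -> R) (mu : {charge set (borel_plane R) -> \bar R}) v j m :
  extension_rule q f -> extension_rule q g -> is_energy_measure q SG f g mu ->
  mu (cell q SG (v ++ nseq m j)) =
  ((5 / 3) ^+ (size v + m) * ((9 / 25) ^+ m / 2) *
   (flux (corner_values q f v) j * flux (corner_values q g v) j +
    9^-1 ^+ m * (antisym_part j (corner_values q f v) (corner_values q g v) *+ 2)))%:E.
Proof.
move=> ef eg [_ ->]; rewrite energy_extension_rule // !corner_nseq //.
by rewrite dirichlet_iter_extend size_cat size_nseq !mulrA.
Qed.

Lemma cvg_perturbed_ratio (R : realType) (P P' N N' : R) :
  N != 0 ->
  (P + 9^-1 ^+ m * P') / (N + 9^-1 ^+ m * N') @[m --> \oo] --> P / N.
Proof.
move=> N0.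
have e0 : 9^-1 ^+ m @[m --> \oo] --> (0 : R).
  apply: cvg_expr; rewrite ger0_norm; lra.
have lin A A' : A + 9^-1 ^+ m * A' @[m --> \oo] --> (A : R).
  rewrite -[X in _ --> X]addr0 -[X in _ + X](mul0r A').
  by apply: cvgD; [exact: cvg_cst | apply: cvgMl].
by apply: cvgM; [exact: lin | apply: cvgV => //; exact: lin].
Qed.

(** * Barycentric coordinates and addresses *)

Definition cross (R : pzRingType) (u v : R * R) : R := u.1 * v.2 - u.2 * v.1.

(** Barycentric coordinate: the signed area of the triangle spanned by [x] and
    the two other vertices, relative to that of the whole triangle. *)
Definition bary (R : realType) (q : 'I_3 -> R * R) (k : 'I_3) (x : R * R) : R :=
  cross (q (k + 1) - x) (q (k + 1 + 1) - x) /
  cross (q 1 - q 0) (q (1 + 1) - q 0).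

(** Twice the area of the triangle, squared, is
    [|u|^2 |v|^2 - (u . v)^2 = 3/4 l^4] for two sides [u] and [v]. *)
Lemma equilateral_cross_neq0 (R : realType) (q : 'I_3 -> R * R) :
  equilateral q -> cross (q 1 - q 0) (q (1 + 1) - q 0) != 0.
Proof.
move=> [l l0 ql].
have sqe i j : i != j ->
    ((q i).1 - (q j).1) ^+ 2 + ((q i).2 - (q j).2) ^+ 2 = l ^+ 2.
  by move=> ij; rewrite -(ql i j ij) sqr_sqrtr // addr_ge0 ?sqr_ge0.
have e10 := sqe 1 0 isT; have e20 := sqe (1 + 1) 0 isT.
have e21 := sqe (1 + 1) 1 isT.
have crossE : cross (q 1 - q 0) (q (1 + 1) - q 0) ^+ 2 =  3 / 4 * (l ^+ 2) ^+ 2.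
  have dotE : ((q 1).1 - (q 0).1) * ((q (1 + 1)).1 - (q 0).1) +
      ((q 1).2 - (q 0).2) * ((q (1 + 1)).2 - (q 0).2) = l ^+ 2 / 2 by lra.
  rewrite -[in RHS]e10.
  have -> : cross (q 1 - q 0) (q (1 + 1) - q 0) ^+ 2 =
     (((q 1).1 - (q 0).1) ^+ 2 + ((q 1).2 - (q 0).2) ^+ 2) *
     (((q (1 + 1)).1 - (q 0).1) ^+ 2 + ((q (1 + 1)).2 - (q 0).2) ^+ 2) -
     (((q 1).1 - (q 0).1) * ((q (1 + 1)).1 - (q 0).1) +
      ((q 1).2 - (q 0).2) * ((q (1 + 1)).2 - (q 0).2)) ^+ 2.
    by rewrite /cross /=; ring.
  by rewrite e10 e20 dotE; field.
by rewrite -sqrf_eq0 crossE !mulf_neq0 ?invr_eq0 ?expf_neq0 ?pnatr_eq0 // gt_eqF.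
Qed.

Lemma bary_affine (R : realType) (q : 'I_3 -> R * R) k (a b : R * R) t :
  bary q k ((1 - t) *: a + t *: b) = (1 - t) * bary q k a + t * bary q k b.
Proof. rewrite /bary !mulrA -mulrDl; congr (_ / _); rewrite /cross /= /GRing.scale /=; ring. Qed.

Lemma bary_cross (R : realType) (q : 'I_3 -> R * R) x :
  let A := cross (q 1 - q 0) (q (1 + 1) - q 0) in
  [/\ bary q 0 x = cross (q 1 - x) (q (1 + 1) - x) / A,
      bary q 1 x = cross (q (1 + 1) - x) (q 0 - x) / A &
      bary q (1 + 1) x = cross (q 0 - x) (q 1 - x) / A].
Proof.
have e3 : 1 + 1 + 1 = 0 :> 'I_3 by apply: val_inj.
by split; rewrite /bary ?e3 ?add0r.
Qed.

Lemma bary_vertex (R : realType) (q : 'I_3 -> R * R) k j :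
  equilateral q -> bary q k (q j) = (k == j)%:R.
Proof.
move=> /equilateral_cross_neq0 A0; have [b0 b1 b2] := bary_cross q (q j).
move: k j A0 b0 b1 b2; apply: ord3_ind; apply: ord3_ind => A0 b0 b1 b2;
  by rewrite ?b0 ?b1 ?b2 /=; move: A0; rewrite /cross /= => A0; field.
Qed.

Lemma sum_bary (R : realType) (q : 'I_3 -> R * R) x :
  equilateral q -> \sum_k bary q k x = 1.
Proof.
move=> /equilateral_cross_neq0; have [b0 b1 b2] := bary_cross q x.
by rewrite sum_ord3 b0 b1 b2 /cross /= => A0; field.
Qed.

Lemma bary_inj (R : realType) (q : 'I_3 -> R * R) x y :
  equilateral q -> bary q ^~ x =1 bary q ^~ y -> x = y.
Proof.
move=> /equilateral_cross_neq0 A0 bxy.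
have E z : (z.1 = \sum_k bary q k z * (q k).1) * (z.2 = \sum_k bary q k z * (q k).2).
  have [b0 b1 b2] := bary_cross q z.
  by rewrite !sum_ord3 b0 b1 b2; move: A0; rewrite /cross /= => A0; split; field.
rewrite [x]surjective_pairing [y]surjective_pairing !E.
by congr pair; apply: eq_bigr => k _; rewrite bxy.
Qed.

Lemma bary_continuous (R : realType) (q : 'I_3 -> R * R) k :
  continuous (bary q k).
Proof.
move=> x; apply: cvgMl; rewrite /cross.
have c1 : (y.1 : R) @[y --> x] --> x.1 by exact: cvg_fst.
have c2 : (y.2 : R) @[y --> x] --> x.2 by exact: cvg_snd.
by apply: cvgB; apply: cvgM; apply: cvgB => //; exact: cvg_cst.
Qed.

Lemma FmapE (R : realType) (q : 'I_3 -> R * R) i x :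
  Fmap q i x = (1 - 2^-1) *: x + 2^-1 *: q i.
Proof. by rewrite /Fmap scalerDr; congr (_ *: _ + _); field. Qed.

Lemma bary_Fmap (R : realType) (q : 'I_3 -> R * R) k i x :
  equilateral q -> bary q k (Fmap q i x) = (bary q k x + (k == i)%:R) / 2.
Proof. by move=> hq; rewrite FmapE bary_affine bary_vertex //; field. Qed.

Lemma Fmap_inj (R : realType) (q : 'I_3 -> R * R) i : injective (Fmap q i).
Proof. by move=> x y /scalerI; rewrite invr_eq0 pnatr_eq0 => /(_ isT)/addIr. Qed.

Lemma Fword_affine (R : realType) (q : 'I_3 -> R * R) w a b t :
  Fword q w ((1 - t) *: a + t *: b) = (1 - t) *: Fword q w a + t *: Fword q w b.
Proof.
elim: w => //= i w ->; rewrite /Fmap [LHS]surjective_pairing [RHS]surjective_pairing.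
by rewrite /= /GRing.scale /=; congr pair; field.
Qed.

Lemma bary_Fword_ge0 (R : realType) (q : 'I_3 -> R * R) w x :
  equilateral q -> (forall k, 0 <= bary q k x) ->
  forall k, 0 <= bary q k (Fword q w x).
Proof.
move=> hq x0; elim: w => //= a w IHw k.
by rewrite bary_Fmap // divr_ge0 // addr_ge0.
Qed.

Lemma bary_Vstar_ge0 (R : realType) (q : 'I_3 -> R * R) w j :
  equilateral q -> forall k, 0 <= bary q k (Fword q w (q j)).
Proof. by move=> hq; apply: bary_Fword_ge0 => // k; rewrite bary_vertex. Qed.

Lemma bary_le1 (R : realType) (q : 'I_3 -> R * R) k x :
  equilateral q -> (forall k, 0 <= bary q k x) -> bary q k x <= 1.
Proof.
move=> hq x0; rewrite -(sum_bary x hq) (bigD1 k) //= lerDl.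
by apply: sumr_ge0 => i _.
Qed.

Lemma bary_ge1 (R : realType) (q : 'I_3 -> R * R) k x :
  equilateral q -> (forall k, 0 <= bary q k x) -> 1 <= bary q k x -> x = q k.
Proof.
move=> hq x0 xk; have {}xk : bary q k x = 1 by apply/eqP; rewrite eq_le bary_le1.
apply: (@bary_inj _ q) => // i; rewrite bary_vertex //.
have [-> //|ik] := eqVneq i k.
have := sum_bary x hq; rewrite (bigD1 k) //= xk => /eqP.
rewrite -subr_eq0 [1 + _]addrC addrK psumr_eq0 // => /allP/(_ i).
by rewrite mem_index_enum ik => /(_ isT)/eqP.
Qed.

(** Two distinct subtriangles share only the midpoint [F_i q_j = F_j q_i]: the
    [j]-th coordinate is at most 1/2 on the first, at least 1/2 on the second,
    and it reaches 1/2 on the first only there. *)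
Lemma Fmap_meet (R : realType) (q : 'I_3 -> R * R) i j x y :
  equilateral q -> (forall k, 0 <= bary q k x) -> (forall k, 0 <= bary q k y) ->
  i != j -> Fmap q i x = Fmap q j y -> x = q j.
Proof.
move=> hq x0 y0 ij /(congr1 (bary q j)); rewrite !bary_Fmap // eqxx.
rewrite eq_sym (negbTE ij) mulr0n mulr1n => e; apply: bary_ge1 => //.
by have := y0 j; lra.
Qed.

(** A vertex may be addressed through a neighbouring cell, but then it is a
    corner of both cells. This makes it possible to rescale a given cell to the
    whole triangle without leaving the vertex set. *)
Lemma Vstar_Fword (R : realType) (q : 'I_3 -> R * R) w z :
  equilateral q -> (forall k, 0 <= bary q k z) ->
  Vstar q (Fword q w z) -> Vstar q z.
Proof.
move=> hq z0; elim: w => //= i w IHw [v [j e]]; apply: IHw.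
have {v e} [a [u e]] : exists a u, Fmap q i (Fword q w z) = Fmap q a (Fword q u (q j)).
  case: v e => [|a u] ->; last by exists a, u.
  by exists j, [::]; rewrite /= Fmap_fix.
have [ia|ia] := eqVneq i a.
  by exists u, j; move: e; rewrite ia => /Fmap_inj.
exists [::], a; apply: (@Fmap_meet _ q i a _ (Fword q u (q j))) => //.
  exact: bary_Fword_ge0.
exact: bary_Vstar_ge0.
Qed.

(** * The flux at a vertex *)

Lemma vertex_inj (R : realType) (q : 'I_3 -> R * R) : equilateral q -> injective q.
Proof.
move=> hq i j /(congr1 (bary q i)); rewrite !bary_vertex // eqxx.
by case: eqVneq => // _ /eqP; rewrite oner_eq0.
Qed.

(** The only addresses of [q i] are [i i ... i], and each additional letter
    multiplies the flux by 3/5. The prefix [w] serves the induction. *)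
Lemma flux_at_outer_vertex (R : realType) (q : 'I_3 -> R * R) v j i :
  equilateral q -> Fword q v (q j) = q i ->
  exists2 c : R, c != 0 & forall f w, extension_rule q f ->
    flux (corner_values q f (w ++ v)) j = c * flux (corner_values q f w) i.
Proof.
move=> hq; elim: v => [|a v IHv] /=.
  by move/(vertex_inj hq)=> ->; exists 1 => [|f w _]; rewrite ?oner_eq0 ?cats0 ?mul1r.
rewrite -[q i in RHS](Fmap_fix q i).
have [-> /Fmap_inj/IHv [c c0 fc]|ai e] := eqVneq a i.
  exists (c * (3 / 5)) => [|f w ef]; first by rewrite mulf_neq0.
  by rewrite -cat_rcons fc // ef flux_extend_same mulrA.
have : q i = q a.
  apply: (@Fmap_meet _ q i a _ (Fword q v (q j))) => //.
  - by move=> k; rewrite bary_vertex.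
  - exact: bary_Vstar_ge0.
  - by rewrite eq_sym.
by move=> /(vertex_inj hq) ia; rewrite ia eqxx in ai.
Qed.

(** Where the two addresses first differ, the vertex is the midpoint shared by
    two subcells, and each remaining address is that of an outer vertex; the
    cancellation of fluxes in [flux_extend_other] then compares the two. *)
Lemma flux_address (R : realType) (q : 'I_3 -> R * R) v j v' j' :
  equilateral q -> Fword q v (q j) = Fword q v' (q j') ->
  exists2 c : R, c != 0 & forall f w, extension_rule q f ->
    flux (corner_values q f (w ++ v)) j = c * flux (corner_values q f (w ++ v')) j'.
Proof.
move=> hq; elim: v v' => [|a v IHv] [|a' v'] /=.
- by move/(vertex_inj hq)=> ->; exists 1 => [|f w _]; rewrite ?oner_eq0 ?mul1r.
- move=> /esym/(@flux_at_outer_vertex R q (a' :: v'))-/(_ hq) [c c0 fc].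
  by exists c^-1 => [|f w ef]; rewrite ?invr_eq0 // cats0 fc // mulKf.
- move=> /(@flux_at_outer_vertex R q (a :: v))-/(_ hq) [c c0 fc].
  by exists c => // f w ef; rewrite cats0 fc.
have [-> /Fmap_inj/IHv [c c0 fc]|aa' e] := eqVneq a a'.
  by exists c => // f w ef; rewrite -!cat_rcons fc.
have v0 := bary_Vstar_ge0 v j hq; have v'0 := bary_Vstar_ge0 v' j' hq.
have [c c0 fc] := flux_at_outer_vertex hq (Fmap_meet hq v0 v'0 aa' e).
rewrite eq_sym in aa'.
have [c' c'0 fc'] := flux_at_outer_vertex hq (Fmap_meet hq v'0 v0 aa' (esym e)).
exists (- (c / c')) => [|f w ef].
  by rewrite oppr_eq0 mulf_neq0 // invr_eq0.
rewrite -!cat_rcons fc // fc' // !ef !flux_extend_other //; last by rewrite eq_sym.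
by field.
Qed.

(** * The derivative at a vertex *)

(** The flux functionals of a cell satisfy no other linear relation than the
    vanishing of their sum. For the whole triangle this is seen on the basis
    [h], and the passage to a subcell is an invertible linear change of
    functionals. *)
Lemma flux_independent (R : realType) (q : 'I_3 -> R * R)
    (h : 'I_3 -> R * R -> R) (w : seq 'I_3) (al : 'I_3 -> R) :
  (forall k, extension_rule q (h k)) ->
  (forall i j, h i (q j) = (i == j)%:R) ->
  (forall k, \sum_a al a * flux (corner_values q (h k) w) a = 0) ->
  forall a b, al a = al b.
Proof.
move=> eh hq; elim/last_ind: w al => [|w i IHw] al alh.
  have E k : al k *+ 3 = \sum_a al a.
    move: (alh k); rewrite /flux /corner_values /= !sum_ord3 !hq.
    by move: k; apply: ord3_ind; rewrite /=; lra.
  by move=> a b; have := E a; have := E b; lra.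
(* The coefficients of the same functional in terms of the fluxes of the larger
   cell. *)
pose ga a := if a == i then (al i *+ 4 - \sum_b al b) / 5 else al a / 5.
have gaE X : \sum_a al a * flux (extend X i) a = \sum_a ga a * flux X a.
  by rewrite /ga; move: i {IHw alh ga}; apply: ord3_ind;
    rewrite !sum_ord3 /= ?flux_extend_same ?flux_extend_other //; field.
have {}IHw := IHw ga (fun k => etrans (esym (gaE _))
  (etrans (congr1 (fun X => \sum_a al a * flux X a) (esym (eh k w i))) (alh k))).
have := IHw 0 1; have := IHw 0 (1 + 1); rewrite /ga sum_ord3.
by move: i {IHw alh gaE ga}; apply: ord3_ind => /= e1 e2;
  apply: ord3_ind; apply: ord3_ind; lra.
Qed.

(** The value of the derivative, as a function of the values [F], [G], [H] that
    a flux functional takes on the functions [f_k], [g_k], [h_i]. *)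
Definition flux_ratio (R : realFieldType) (n : nat) (c F G : 'I_n -> R)
    (H : 'I_3 -> R) : R :=
  (\sum_k c k * (F k * G k)) / \sum_i H i ^+ 2.

Lemma flux_ratio_scale (R : realFieldType) n (c F G : 'I_n -> R) H (l : R) :
  l != 0 ->
  flux_ratio c (fun k => l * F k) (fun k => l * G k) (fun i => l * H i) =
  flux_ratio c F G H.
Proof.
move=> l0; rewrite /flux_ratio.
have -> : \sum_k c k * (l * F k * (l * G k)) =
    l ^+ 2 * \sum_k c k * (F k * G k).
  by rewrite mulr_sumr; apply: eq_bigr => k _; ring.
have -> : \sum_i (l * H i) ^+ 2 = l ^+ 2 * \sum_i H i ^+ 2.
  by rewrite mulr_sumr; apply: eq_bigr => k _; ring.
by rewrite -mulf_div divff ?mul1r // expf_neq0.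
Qed.

Lemma sum_sqr_neq0 (R : realFieldType) (H : 'I_3 -> R) :
  (\sum_i H i ^+ 2 != 0) = [exists i, H i != 0].
Proof.
rewrite psumr_neq0; last by move=> i _; rewrite sqr_ge0.
apply/hasP/existsP => [[i _ Hi]|[i Hi]]; last first.
  by exists i; rewrite ?mem_index_enum // lt0r expf_neq0 //= sqr_ge0.
by exists i; apply: contraTneq Hi => ->; rewrite expr0n ltxx.
Qed.

(** A combination of two of the three fluxes with coefficients not both zero
    gives the third flux the coefficient 0, so by [flux_independent] it does
    not vanish on the whole basis [h]. This is what makes the denominators of
    the derivative nonzero. *)
Lemma flux_combination_neq0 (R : realType) (q : 'I_3 -> R * R)
    (h : 'I_3 -> R * R -> R) (w : seq 'I_3) (i j : 'I_3) (al be : R) :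
  (forall k, extension_rule q (h k)) ->
  (forall i j, h i (q j) = (i == j)%:R) ->
  i != j -> (al, be) != 0 ->
  \sum_k (al * flux (corner_values q (h k) w) i + be * flux (corner_values q (h k) w) j) ^+ 2
    != 0.
Proof.
move=> eh hq ij ab0; rewrite sum_sqr_neq0.
apply: contraNT ab0; rewrite negb_exists => /forallP H0.
pose ga a : R := if a == i then al else if a == j then be else 0.
have gaE : forall a b, ga a = ga b.
  apply: (@flux_independent _ q h w) => // k.
  have /negPn/eqP := H0 k; apply: etrans.
  rewrite (bigD1 i) //= (bigD1 j) /=; last by rewrite eq_sym.
  rewrite big1 ?addr0 => [|a /andP[ai aj]]; last first.
    by rewrite /ga (negbTE ai) (negbTE aj) mul0r.
  by rewrite /ga eqxx eq_sym (negbTE ij) eqxx.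
have [k ki kj] : exists2 k, k != i & k != j.
  by move: i j ij {H0 ga gaE}; apply: ord3_ind; apply: ord3_ind => // _;
    (do ?[by exists 0]); (do ?[by exists 1]); by exists (1 + 1).
have := gaE i k; have := gaE j k.
rewrite /ga !eqxx (negbTE ki) (negbTE kj) eq_sym (negbTE ij) => -> ->.
by [].
Qed.

Lemma cell_ratio_cvg (R : realType) (q : 'I_3 -> R * R) (SG : set (R * R))
    (h : 'I_3 -> R * R -> R)
    (nu : 'I_3 -> {charge set (borel_plane R) -> \bar R})
    (sigma : {charge set (borel_plane R) -> \bar R})
    (n : nat) (c : 'I_n -> R) (f g : 'I_n -> R * R -> R)
    (mu : 'I_n -> {charge set (borel_plane R) -> \bar R}) v j :
  compact SG ->
  (forall i, extension_rule q (h i)) ->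
  (forall i j, h i (q j) = (i == j)%:R) ->
  (forall i, is_energy_measure q SG (h i) (h i) (nu i)) ->
  (forall k, extension_rule q (f k)) -> (forall k, extension_rule q (g k)) ->
  (forall k, is_energy_measure q SG (f k) (g k) (mu k)) ->
  (forall A : set (borel_plane R), measurable A ->
      sigma A = (\sum_(k < n) (c k)%:E * mu k A)%E) ->
  cell_ratio q SG sigma (kusuoka nu) v j m @[m --> \oo] -->
  flux_ratio c (fun k => flux (corner_values q (f k) v) j)
    (fun k => flux (corner_values q (g k) v) j) (fun i => flux (corner_values q (h i) v) j).
Proof.
move=> cSG eh hq hnu ef eg hmu sigmaE.
set N := \sum_i flux (corner_values q (h i) v) j ^+ 2.
have N0 : N != 0.
  (* The flux at [j] is a combination with coefficients 1 and 0, the second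
     corner being arbitrary. *)
  pose i : 'I_3 := j + 1.
  have ji : j != i by rewrite /i; move: (j); apply: ord3_ind.
  have := @flux_combination_neq0 _ q h v j i 1 0 eh hq ji.
  rewrite /N; under eq_bigr do rewrite mul1r mul0r addr0; apply.
  by rewrite xpair_eqE oner_eq0.
pose N' := \sum_i antisym_part j (corner_values q (h i) v) (corner_values q (h i) v) *+ 2.
pose P' := \sum_k c k * (antisym_part j (corner_values q (f k) v) (corner_values q (g k) v) *+ 2).
rewrite /flux_ratio -/N.
have := @cvg_perturbed_ratio R (\sum_k c k * (flux (corner_values q (f k) v) j *
  flux (corner_values q (g k) v) j)) P' N N' N0.
apply: cvg_trans; apply: near_eq_cvg; apply: nearW => m; rewrite /cell_ratio.
pose K : R := (5 / 3) ^+ (size v + m) * ((9 / 25) ^+ m / 2).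
have -> : sigma (cell q SG (v ++ nseq m j)) =
    (K * (\sum_k c k * (flux (corner_values q (f k) v) j * flux (corner_values q (g k) v) j) +
      9^-1 ^+ m * P'))%:E.
  rewrite sigmaE; last exact: measurable_cell.
  under eq_bigr => k _ do rewrite (energy_measure_cell v j m (ef k) (eg k) (hmu k)).
  rewrite sumEFin; congr _%:E; rewrite /P' [in RHS]mulr_sumr -big_split mulr_sumr.
  by apply: eq_bigr => k _; rewrite -/K /=; ring.
have -> : kusuoka nu (cell q SG (v ++ nseq m j)) = (K * (N + 9^-1 ^+ m * N'))%:E.
  rewrite /kusuoka.
  under eq_bigr => k _ do rewrite (energy_measure_cell v j m (eh k) (eh k) (hnu k)).
  rewrite sumEFin; congr _%:E; rewrite /N' /N [in RHS]mulr_sumr -big_split mulr_sumr.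
  by apply: eq_bigr => k _; rewrite -/K /=; ring.
rewrite /= -mulf_div divff ?mul1r //.
by rewrite !mulf_neq0 ?expf_neq0 ?mulf_neq0 ?invr_eq0 ?pnatr_eq0.
Qed.

Lemma energy_derivativeE (R : realType) (q : 'I_3 -> R * R) (SG : set (R * R))
    (h : 'I_3 -> R * R -> R)
    (nu : 'I_3 -> {charge set (borel_plane R) -> \bar R})
    (sigma : {charge set (borel_plane R) -> \bar R})
    (n : nat) (c : 'I_n -> R) (f g : 'I_n -> R * R -> R)
    (mu : 'I_n -> {charge set (borel_plane R) -> \bar R}) v j :
  equilateral q -> compact SG ->
  (forall i, extension_rule q (h i)) ->
  (forall i j, h i (q j) = (i == j)%:R) ->
  (forall i, is_energy_measure q SG (h i) (h i) (nu i)) ->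
  (forall k, extension_rule q (f k)) -> (forall k, extension_rule q (g k)) ->
  (forall k, is_energy_measure q SG (f k) (g k) (mu k)) ->
  (forall A : set (borel_plane R), measurable A ->
      sigma A = (\sum_(k < n) (c k)%:E * mu k A)%E) ->
  energy_derivative q SG sigma (kusuoka nu) (Fword q v (q j)) =
  flux_ratio c (fun k => flux (corner_values q (f k) v) j)
    (fun k => flux (corner_values q (g k) v) j) (fun i => flux (corner_values q (h i) v) j).
Proof.
move=> hq cSG eh hhq hnu ef eg hmu sigmaE.
have ratio u i := @cell_ratio_cvg R q SG h nu sigma n c f g mu u i
  cSG eh hhq hnu ef eg hmu sigmaE.
apply: get_unique => [u i /(flux_address hq) [l l0 fl] | y /(_ v j erefl) yl].
  have fl0 f' : extension_rule q f' ->
      flux (corner_values q f' v) j = l * flux (corner_values q f' u) i by exact: fl f' [::].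
  have -> : (fun k => flux (corner_values q (f k) v) j) =
      (fun k => l * flux (corner_values q (f k) u) i) by apply/funext => k; exact: fl0.
  have -> : (fun k => flux (corner_values q (g k) v) j) =
      (fun k => l * flux (corner_values q (g k) u) i) by apply/funext => k; exact: fl0.
  have -> : (fun k => flux (corner_values q (h k) v) j) =
      (fun k => l * flux (corner_values q (h k) u) i) by apply/funext => k; exact: fl0.
  by rewrite flux_ratio_scale //; exact: ratio.
exact: cvg_unique yl (ratio v j).
Qed.

(** * The flux direction along an edge *)

(** The effect on the slope of passing to the subcell [a] of an edge with
    corner [i]; any [a] different from [i] stands for the other end. *)
Definition edge_step {R : realFieldType} (i a : 'I_3) (s : R) : R :=
  if a == i then (1 + 2 * s) / (2 + s) else s / (3 - s).

(** The parameter [t] for which the flux functional at the vertex of address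
    [(u, k)] is proportional to [t flux_i - (1 - t) flux_j]. *)
Fixpoint edge_slope {R : realFieldType} (i : 'I_3) (u : seq 'I_3) (k : 'I_3) : R :=
  if u is a :: u' then edge_step i a (edge_slope i u' k) else (k == i)%:R.

Lemma edge_step_itv (R : realFieldType) (i a : 'I_3) (s : R) :
  0 <= s <= 1 -> 0 <= edge_step i a s <= 1.
Proof.
move=> /andP[s0 s1]; rewrite /edge_step; case: ifP => _.
  by rewrite divr_ge0 ?ler_pdivrMr ?mul1r //=; lra.
by rewrite divr_ge0 ?ler_pdivrMr ?mul1r //=; lra.
Qed.

Lemma edge_slope_itv (R : realFieldType) i u k :
  0 <= (edge_slope i u k : R) <= 1.
Proof.
elim: u => [|a u IHu] /=; last exact: edge_step_itv.
by case: eqP; rewrite lexx ler01.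
Qed.

(** Both differences equal [3 (s - t) / (A B)] with denominators [A, B >= 2]. *)
Lemma edge_step_contract (R : realFieldType) (i a : 'I_3) (s t : R) :
  0 <= s <= 1 -> 0 <= t <= 1 ->
  `|edge_step i a s - edge_step i a t| <= 3 / 4 * `|s - t|.
Proof.
move=> /andP[s0 s1] /andP[t0 t1].
have key (A B : R) : 2 <= A -> 2 <= B -> `|(s - t) * (3 / (A * B))| <= 3 / 4 * `|s - t|.
  move=> A2 B2; rewrite normrM mulrC ler_wpM2r // ger0_norm; last first.
    by rewrite divr_ge0 // mulr_ge0 //; lra.
  rewrite ler_pdivrMr; last by rewrite mulr_gt0; lra.
  by nra.
rewrite /edge_step; case: ifP => _.
  have -> : (1 + 2 * s) / (2 + s) - (1 + 2 * t) / (2 + t) =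
      (s - t) * (3 / ((2 + s) * (2 + t))) by field; apply/andP; split; lra.
  by apply: key; lra.
have -> : s / (3 - s) - t / (3 - t) = (s - t) * (3 / ((3 - s) * (3 - t))).
  by field; apply/andP; split; lra.
by apply: key; lra.
Qed.

Lemma edge_step_fix (R : realFieldType) (i a : 'I_3) :
  edge_step i a (a == i)%:R = (a == i)%:R :> R.
Proof. by rewrite /edge_step; case: eqP => _ /=; rewrite ?mul0r //; field. Qed.

(** The inner ends of the two half edges carry the same slope: this is what
    glues the two halves of the edge continuously. *)
Lemma edge_step_mid (R : realFieldType) (i a : 'I_3) :
  edge_step i a (a != i)%:R = 2^-1 :> R.
Proof. by rewrite /edge_step; case: eqP => _ /=; field. Qed.

(** Prepending a letter rewrites [flux_i] and [flux_j] of the subcell in terms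
    of those of the cell ([flux_extend_same], [flux_extend_other]). The form
    [t flux_i - (1 - t) flux_j] is preserved up to a factor, which is positive
    because [0 <= t <= 1]. *)
Lemma flux_edge (R : realType) (q : 'I_3 -> R * R) i j u k :
  i != j -> pred2 i j k -> all (pred2 i j) u ->
  exists2 c : R, c != 0 & forall f w, extension_rule q f ->
    flux (corner_values q f (w ++ u)) k =
    c * (edge_slope i u k * flux (corner_values q f w) i -
         (1 - edge_slope i u k) * flux (corner_values q f w) j).
Proof.
move=> ij ijk; have ji : j != i by rewrite eq_sym.
elim: u => [_|a u IHu /= /andP[aij]] /=.
  case/orP: ijk => /eqP ->.
    by exists 1; [rewrite oner_eq0|move=> f w ef; rewrite cats0 eqxx mulr1n; ring].
  by exists (-1); [rewrite oppr_eq0 oner_eq0|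
    move=> f w ef; rewrite cats0 (negbTE ji) mulr0n; ring].
move=> /IHu [c c0 fc]; have /andP[s0 s1] := edge_slope_itv R i u k.
case/orP: aij => /eqP ->; rewrite /edge_step ?eqxx ?(negbTE ji).
  exists (c * ((2 + edge_slope i u k) / 5)) => [|f w ef].
    by rewrite !mulf_neq0 // ?invr_eq0 // gt_eqF //; lra.
  rewrite -cat_rcons fc // ef flux_extend_same flux_extend_other //.
  by field; lra.
exists (c * ((3 - edge_slope i u k) / 5)) => [|f w ef].
  by rewrite !mulf_neq0 // ?invr_eq0 // gt_eqF //; lra.
rewrite -cat_rcons fc // ef flux_extend_same flux_extend_other //.
by field; lra.
Qed.

(** On the edge from [i] to [j] the third barycentric coordinate vanishes, and
    a letter other than [i] and [j] would make it positive. *)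
Lemma edge_address (R : realType) (q : 'I_3 -> R * R) (i j : 'I_3) u k :
  equilateral q ->
  (forall l, ~~ pred2 i j l -> bary q l (Fword q u (q k)) = 0) ->
  pred2 i j k && all (pred2 i j) u.
Proof.
move=> hq; elim: u => [|a u IHu] /= b0.
  rewrite andbT; apply: contraT => /b0/eqP.
  by rewrite bary_vertex // eqxx oner_eq0.
have {}b0 l : ~~ pred2 i j l -> bary q l (Fword q u (q k)) = 0 /\ a != l.
  move=> /b0; rewrite bary_Fmap // => /eqP.
  rewrite mulf_eq0 invr_eq0 pnatr_eq0 orbF paddr_eq0 ?bary_Vstar_ge0 //.
  by rewrite pnatr_eq0 eqb0 [l == a]eq_sym => /andP[/eqP -> ->].
have /= /andP[-> ->] := IHu (fun l ijl => (b0 l ijl).1); rewrite andbT /=.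
by apply: contraT => /b0[_]; rewrite eqxx.
Qed.

(** Empty words are avoided through [F_k q_k = q_k]. *)
Lemma edge_address_cons (R : realType) (q : 'I_3 -> R * R) (i j : 'I_3) u k :
  pred2 i j k -> all (pred2 i j) u ->
  exists a v, [/\ pred2 i j a, all (pred2 i j) v,
    Fword q u (q k) = Fmap q a (Fword q v (q k)) &
    edge_slope i u k = edge_step i a (edge_slope i v k) :> R].
Proof.
move=> ijk; case: u => [_|a u /= /andP[aij uij]]; last by exists a, u.
by exists k, [::]; rewrite /= Fmap_fix edge_step_fix.
Qed.

(** A vertex at distance less than 1/2 from an end lies in the half edge at
    that end, whose step map fixes the slope of the end. *)
Lemma edge_slope_near_end (R : realType) (q : 'I_3 -> R * R) i j e m u k :
  equilateral q -> i != j -> pred2 i j e -> pred2 i j k -> all (pred2 i j) u ->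
  `|bary q j (Fword q u (q k)) - (j == e)%:R| < 2^-1 ^+ m ->
  `|edge_slope i u k - (e == i)%:R| <= (3 / 4) ^+ m :> R.
Proof.
move=> hq ij ije ijk; elim: m u => [|m IHm] u uij.
  move=> _; have /andP[s0 s1] := edge_slope_itv R i u k; rewrite expr0.
  by case: eqP => _; rewrite ?mulr1n ?mulr0n ler_norml; apply/andP; split; lra.
have [a [v [aij vij -> ->]]] := edge_address_cons q ijk uij.
rewrite bary_Fmap // !exprS => near_e.
have v0 := bary_Vstar_ge0 v k hq; have v1 := bary_le1 j hq v0.
have {}v0 := v0 j.
have [ae|ae] := eqVneq a e.
  subst e; rewrite -{1}(edge_step_fix R i a).
  apply: le_trans (edge_step_contract _ _ _ _) _.
  - exact: edge_slope_itv.
  - by case: eqP; rewrite lexx ler01.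
  rewrite ler_wpM2l ?divr_ge0 //; apply: IHm => //.
  move: near_e.
  have -> : (bary q j (Fword q v (q k)) + (j == a)%:R) / 2 - (j == a)%:R =
    (bary q j (Fword q v (q k)) - (j == a)%:R) / 2 by field.
  by rewrite normrM [`|2^-1|]ger0_norm ?invr_ge0 // mulrC ltr_pM2l ?invr_gt0.
have : 2^-1 <= `|(bary q j (Fword q v (q k)) + (j == a)%:R) / 2 - (j == e)%:R|.
  have ji : j != i by rewrite eq_sym.
  case/orP: ije ae near_e => /eqP ->; case/orP: aij => /eqP ->; rewrite ?eqxx // => _ _.
    by rewrite (negbTE ji) ler_normr mulr1n mulr0n; apply/orP; left; lra.
  by rewrite (negbTE ji) ler_normr mulr1n mulr0n; apply/orP; right; lra.
move=> far_e; have := le_lt_trans far_e near_e.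
rewrite -[X in X < _]mulr1 ltr_pM2l ?invr_gt0 // ltNge exprn_ile1 //; lra.
Qed.

(** Two vertices in the same half edge are handled by rescaling. If they lie in
    different halves, each of them is close to the midpoint, which is an end of
    both halves; comparing each slope with the slope 1/2 of the midpoint costs
    the factor 2. *)
Lemma edge_slope_close (R : realType) (q : 'I_3 -> R * R) i j m u k u' k' :
  equilateral q -> i != j ->
  pred2 i j k -> all (pred2 i j) u -> pred2 i j k' -> all (pred2 i j) u' ->
  `|bary q j (Fword q u (q k)) - bary q j (Fword q u' (q k'))| < 2^-1 ^+ m ->
  `|edge_slope i u k - edge_slope i u' k'| <= 2 * (3 / 4) ^+ m :> R.
Proof.
move=> hq ij ijk + ijk'; elim: m u u' => [|m IHm] u u' uij u'ij.
  move=> _; have /andP[s0 s1] := edge_slope_itv R i u k; rewrite expr0.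
  by have /andP[t0 t1] := edge_slope_itv R i u' k'; rewrite ler_norml; apply/andP; split; lra.
have [a [v [aij vij -> ->]]] := edge_address_cons q ijk uij.
have [a' [v' [a'ij v'ij -> ->]]] := edge_address_cons q ijk' u'ij.
move: {u u' uij u'ij} a a' v v' k k' aij a'ij vij v'ij ijk ijk' IHm.
have ji : j != i by rewrite eq_sym.
(* The case of two vertices on the two sides of the midpoint. *)
have diff v v' k k' : all (pred2 i j) v -> all (pred2 i j) v' -> pred2 i j k ->
   pred2 i j k' -> 
   `|bary q j (Fmap q i (Fword q v (q k))) -
     bary q j (Fmap q j (Fword q v' (q k')))| < 2^-1 ^+ m.+1 ->
   `|edge_step i i (edge_slope i v k) - edge_step i j (edge_slope i v' k')| <=
   2 * (3 / 4) ^+ m.+1 :> R.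
  move=> vij v'ij ijk ijk'; rewrite !bary_Fmap // eqxx (negbTE ji) exprS.
  have v0 := bary_Vstar_ge0 v k hq; have v1 := bary_le1 j hq v0.
  have v'0 := bary_Vstar_ge0 v' k' hq j; have {}v0 := v0 j.
  rewrite ltr_norml mulr1n mulr0n => /andP[close _].
  have nv : `|edge_slope i v k - (j == i)%:R| <= (3 / 4) ^+ m :> R.
    apply: (edge_slope_near_end hq ij) => //; first by rewrite /= eqxx orbT.
    by rewrite eqxx ltr_norml mulr1n; apply/andP; split; lra.
  have nv' : `|edge_slope i v' k' - (i == i)%:R| <= (3 / 4) ^+ m :> R.
    apply: (edge_slope_near_end hq ij) => //; first by rewrite /= eqxx.
    by rewrite (negbTE ji) ltr_norml mulr0n; apply/andP; split; lra.
  apply: le_trans (ler_distD 2^-1 _ _) _.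
  rewrite exprS mulrA [2 * _]mulrC -mulrA [2 * _]mulrDl mul1r mulrDr lerD //.
    rewrite -(edge_step_mid R i i) eqxx /=.
    apply: le_trans (edge_step_contract _ _ _ _) _; rewrite ?edge_slope_itv ?lexx ?ler01 //.
    by rewrite ler_wpM2l ?divr_ge0 //; move: nv; rewrite (negbTE ji).
  rewrite distrC -(edge_step_mid R i j) ji /=.
  apply: le_trans (edge_step_contract _ _ _ _) _; rewrite ?edge_slope_itv ?lexx ?ler01 //.
  by rewrite ler_wpM2l ?divr_ge0 //; move: nv'; rewrite eqxx.
move=> a a' v v' k k' aij a'ij vij v'ij ijk ijk' IHm.
have [<-|] := eqVneq a a'.
  rewrite !bary_Fmap // => close.
  apply: le_trans (edge_step_contract _ _ _ _) _; rewrite ?edge_slope_itv //.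
  rewrite exprS mulrCA ler_wpM2l ?divr_ge0 //; apply: IHm => //.
  move: close; set b := bary _ _ _; set b' := bary _ _ _.
  have -> : (b + (j == a)%:R) / 2 - (b' + (j == a)%:R) / 2 = (b - b') / 2 by field.
  by rewrite normrM [`|2^-1|]ger0_norm ?invr_ge0 // mulrC exprS ltr_pM2l ?invr_gt0.
case/orP: aij => /eqP ->; case/orP: a'ij => /eqP ->; rewrite ?eqxx // => _.
  exact: diff.
by rewrite distrC [in X in _ -> X]distrC; exact: diff.
Qed.

(** * Continuity along an edge *)

Lemma edge_address_exists (R : realType) (q : 'I_3 -> R * R) w i j x :
  equilateral q -> i != j -> segment (Fword q w (q i)) (Fword q w (q j)) x ->
  Vstar q x -> exists u k,
  [/\ pred2 i j k, all (pred2 i j) u & x = Fword q w (Fword q u (q k))].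
Proof.
move=> hq ij [t /=]; rewrite in_itv /= => /andP[t0 t1] <-.
rewrite -Fword_affine; set z := _ + _ => Vz.
have bz l : bary q l z = (1 - t) * (l == i)%:R + t * (l == j)%:R.
  by rewrite /z bary_affine !bary_vertex.
have z0 l : 0 <= bary q l z by rewrite bz addr_ge0 // mulr_ge0 // subr_ge0.
have [u [k zE]] := Vstar_Fword hq z0 Vz.
have /andP[kij uij] : pred2 i j k && all (pred2 i j) u.
  apply: (edge_address hq) => l /norP[li lj].
  by rewrite -zE bz (negbTE li) (negbTE lj) !mulr0 addr0.
by exists u, k; rewrite -zE.
Qed.

Lemma segment_closed (R : realType) (a b : R * R) : closed (segment a b).
Proof.
apply: compact_closed; first exact: norm_hausdorff.
apply: continuous_compact; last exact: segment_compact.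
apply: continuous_subspaceT => t.
apply: cvgD; apply: cvgZl; last exact: cvg_id.
by apply: cvgB; [exact: cvg_cst|exact: cvg_id].
Qed.

Lemma bary_Fword_sub (R : realType) (q : 'I_3 -> R * R) w l x y :
  equilateral q ->
  bary q l (Fword q w x) - bary q l (Fword q w y) =
  2^-1 ^+ size w * (bary q l x - bary q l y).
Proof.
move=> hq; elim: w => [|a w IHw] /=; first by rewrite expr0 mul1r.
by rewrite exprS -mulrA -IHw !bary_Fmap //; field.
Qed.

Lemma flux_ratio_continuous (R : realType) n (c : 'I_n -> R) 
  (F F' G G' : 'I_n -> R) (H H' : 'I_3 -> R) (t : R) :
  \sum_i (t * H i - (1 - t) * H' i) ^+ 2 != 0 ->
  {for t, continuous (fun s : R => flux_ratio c (fun k => s * F k - (1 - s) * F' k)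
    (fun k => s * G k - (1 - s) * G' k) (fun i => s * H i - (1 - s) * H' i))}.
Proof.
move=> H0.
have lin (a b : R) : s * a - (1 - s) * b @[s --> t] --> t * a - (1 - t) * b.
  apply: cvgB; apply: cvgMl; first exact: cvg_id.
  by apply: cvgB; [exact: cvg_cst | exact: cvg_id].
rewrite /flux_ratio /continuous_at; apply: cvgM; last apply: cvgV => //.
  apply: cvg_big => [|k _]; first exact: add_continuous.
  by apply: cvgMr; apply: cvgM.
apply: cvg_big => [|k _]; first exact: add_continuous.
by under eq_fun do rewrite expr2; rewrite expr2; apply: cvgM.
Qed.

(** Continuity of [D] follows from that of [G], since the slope of a vertex
    depends continuously on its barycentric coordinate [j]. *)
Lemma edge_continuous (R : realType) (q : 'I_3 -> R * R) w i j
    (D : R * R -> R) (G : R -> R) :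
  equilateral q -> i != j -> continuous G ->
  (forall u k, pred2 i j k -> all (pred2 i j) u ->
     D (Fword q w (Fword q u (q k))) = G (edge_slope i u k)) ->
  {within segment (Fword q w (q i)) (Fword q w (q j)) `&` Vstar q, continuous D}.
Proof.
move=> hq ij Gcont DG; apply/subspace_continuousP => x [xE Vx].
have [u [k [kij uij {x xE Vx}->]]] := edge_address_exists hq ij xE Vx.
apply/cvgrPdist_lt => eps eps0; rewrite /from_subspace DG //.
have /cvgrPdist_lt/(_ eps eps0)/nbhs_ballP [d /= d0 Gd] := Gcont (edge_slope i u k).
have [m md] : exists m, 2 * (3 / 4) ^+ m < d :> R.
  have e0 : 2 * (3 / 4) ^+ m @[m --> \oo] --> (2 * 0 : R).
    by apply: cvgMr; apply: cvg_expr; rewrite ger0_norm; lra.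
  move/cvgrPdist_lt: e0 => /(_ d d0) [m _ /(_ m (leqnn m))] /=.
  by rewrite mulr0 sub0r normrN ger0_norm ?mulr_ge0 ?exprn_ge0 ?divr_ge0 // => ?; exists m.
(* [F_w] shrinks barycentric coordinates by the factor [2^-|w|]. *)
have del0 : 0 < 2^-1 ^+ size w * 2^-1 ^+ m :> R.
  by rewrite mulr_gt0 ?exprn_gt0 ?invr_gt0.
have /cvgrPdist_lt/(_ _ del0) close := @bary_continuous R q j (Fword q w (Fword q u (q k))).
apply: filterS close => y close [yE Vy].
have [u' [k' [k'ij u'ij {Vy}yE']]] := edge_address_exists hq ij yE Vy.
move: close; rewrite yE' bary_Fword_sub // normrM ger0_norm ?exprn_ge0 ?invr_ge0 //.
rewrite ltr_pM2l ?exprn_gt0 ?invr_gt0 // => /edge_slope_close close.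
rewrite DG //; apply: Gd; rewrite /ball /=.
by apply: le_lt_trans md; apply: close.
Qed.

Theorem theorem5p5 (R : realType) (q : 'I_3 -> R * R) (SG : set (R * R))
    (h : 'I_3 -> R * R -> R)
    (nu : 'I_3 -> {charge set (borel_plane R) -> \bar R})
    (sigma : {charge set (borel_plane R) -> \bar R}) (w : seq 'I_3)
    (hq : equilateral q) (hSG : is_SG q SG)
    (hh : harmonic_basis q SG h)
    (hnu : forall i : 'I_3, is_energy_measure q SG (h i) (h i) (nu i))
    (hsigma : harmonic_energy_measure q SG sigma) :
  {within cell_edges q w `&` Vstar q,
    continuous (energy_derivative q SG sigma (kusuoka nu))}.
Proof.
have [_ cSG _] := hSG.
have eh i : extension_rule q (h i) by apply: harmonic_extension_rule (hh i).1.
have hhq i j : h i (q j) = (i == j)%:R := (hh i).2 j.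
have [n [c [f [g [mu [hk sigmaE]]]]]] := hsigma.
have ef k : extension_rule q (f k) by have [/harmonic_extension_rule] := hk k.
have eg k : extension_rule q (g k) by have [_ /harmonic_extension_rule] := hk k.
have hmu k : is_energy_measure q SG (f k) (g k) (mu k) by have [] := hk k.
have DE v k := @energy_derivativeE R q SG h nu sigma n c f g mu v k
  hq cSG eh hhq hnu ef eg hmu sigmaE.
set D := energy_derivative q SG sigma (kusuoka nu).
have Dedge i j : i != j ->
    {within segment (Fword q w (q i)) (Fword q w (q j)) `&` Vstar q, continuous D}.
  move=> ij.
  pose G t := flux_ratio c
    (fun k => t * flux (corner_values q (f k) w) i - (1 - t) * flux (corner_values q (f k) w) j)
    (fun k => t * flux (corner_values q (g k) w) i - (1 - t) * flux (corner_values q (g k) w) j)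
    (fun k => t * flux (corner_values q (h k) w) i - (1 - t) * flux (corner_values q (h k) w) j).
  apply: (@edge_continuous _ q w i j D G) => // [t|u k kij uij].
    apply: flux_ratio_continuous.
    have := @flux_combination_neq0 _ q h w i j t (- (1 - t)) eh hhq ij.
    under eq_bigr => k _ do rewrite mulNr.
    by apply; rewrite xpair_eqE; apply/negP => /andP[/eqP -> ]; rewrite subr0 oppr_eq0 oner_eq0.
  have [l l0 fl] := @flux_edge R q i j u k ij kij uij.
  rewrite -Fword_cat /D DE /G -[RHS](flux_ratio_scale _ _ _ _ l0).
  by congr (flux_ratio c _ _ _); apply/funext => a; apply: fl.
apply/subspace_continuousP => x [_ Vx]; apply/cvgrPdist_lt => eps eps0.
have near_edge i j : \forall y \near x, i != j ->
    segment (Fword q w (q i)) (Fword q w (q j)) y -> Vstar q y -> `|D x - D y| < eps.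
  have [ij|ij] := boolP (i != j); last by near=> y.
  have [xij|xij] := pselect (segment (Fword q w (q i)) (Fword q w (q j)) x).
    have /subspace_continuousP/(_ x (conj xij Vx)) := Dedge i j ij.
    move=> /cvgrPdist_lt/(_ _ eps0); rewrite near_withinE => close.
    by near=> y => _ yij Vy; apply: (near close y).
  (* An edge that misses [x] is closed, so it also misses a neighbourhood. *)
  have := closed_openC (@segment_closed R (Fword q w (q i)) (Fword q w (q j))).
  move=> oC; have := open_nbhs_nbhs (conj oC xij).
  move=> far; near=> y => _ yij _; exfalso.
  by have : (~` segment (Fword q w (q i)) (Fword q w (q j))) y by near: y.
have near_edges := filter_forall (nbhs_filter x)
  (fun i => filter_forall (nbhs_filter x) (near_edge i)).
rewrite near_withinE; near=> y => -[[i [j [ij yij]]] Vy].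
suff : forall i j, i != j ->
    segment (Fword q w (q i)) (Fword q w (q j)) y -> Vstar q y ->
    `|D x - D y| < eps by apply; [exact: ij|exact: yij|].
by near: y; exact: near_edges.
Unshelve. all: by end_near.
Qed.
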